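(* Let $K\in\mathcal{P}(m,n)$ ($3\le n\le m$) and let $A$ be a $K$-primitive matrix. Then the length of the shortest circuit in the digraph $(\mathcal{E},\mathcal{P}(A,K))$ equals $m-1$ if and only if the digraph $(\mathcal{E},\mathcal{P}(A,K))$ is, apart from the labelling of its vertices, given by $F_1$ or $F_2$, or (in case $m=n=3$) by the digraph of order $3$ whose arcs are precisely all possible arcs between every pair of distinct vertices.
   Context: A proper cone $K$ in $\mathbb{R}^n$ is a closed convex cone that is pointed ($K\cap(-K)=\{0\}$) and has nonempty interior. A face of $K$ is a subcone $F\subseteq K$ such that $y\in F$ whenever $x\in F$ and $y,x-y\in K$. For $x\in K$, $\Phi(x)$ is the smallest face of $K$ containing $x$. A nonzero $x\in K$ is an extreme vector if $\Phi(x)=\{\lambda x:\lambda\ge0\}$, which is then an extreme ray. A polyhedral cone is a proper cone with finitely many extreme rays; $\mathcal{P}(m,n)$ is the set of $n$-dimensional polyhedral cones with exactly $m$ extreme rays. $\pi(K)$ is the set of real matrices $A$ with $AK\subseteq K$. $A\in\pi(K)$ is $K$-primitive if $A^p(K\setminus\{0\})\subseteq\operatorname{int}K$ for some positive integer $p$. For $A\in\pi(K)$, $(\mathcal{E},\mathcal{P}(A,K))$ is the digraph whose vertices are the extreme rays of $K$, with an arc $(\Phi(x),\Phi(y))$ whenever $\Phi(y)\subseteq\Phi(Ax)$ (loops allowed). A circuit is a directed cycle with no repeated vertices, a loop being a circuit of length $1$. $F_1$ is the digraph on vertices $x_1,\ldots,x_m$ with arcs $x_i\to x_{i+1}$ ($1\le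 i\le m-1$), $x_m\to x_1$ and $x_m\to x_2$. $F_2$ is $F_1$ together with the additional arc $x_1\to x_3$. *)

(* Defs.v *)
From HB Require Import structures.
From mathcomp Require Import all_boot all_order all_algebra.
From mathcomp Require Import all_classical all_reals all_analysis.

Set Implicit Arguments.
Unset Strict Implicit.
Unset Printing Implicit Defensive.

Import Order.TTheory GRing.Theory Num.Theory.
Import numFieldNormedType.Exports.

Local Open Scope classical_set_scope.
Local Open Scope ring_scope.

Section Cones.
Context {R : realType} {n : nat}.
Implicit Types (K F G : set 'cV[R]_n) (x y : 'cV[R]_n) (A : 'M[R]_n).

Definition convex_cone K : Prop :=
  [/\ K 0,
      forall x y, K x -> K y -> K (x + y) &
      forall (a : R) x, 0 <= a -> K x -> K (a *: x)].

Definition proper_cone K : Prop :=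
  [/\ convex_cone K,
      closed K,
      K `&` [set - x | x in K] = [set 0] &
      interior K !=set0].

Definition face K F : Prop :=
  [/\ convex_cone F,
      F `<=` K &
      forall x y, F x -> K y -> K (x - y) -> F y].

(* An intersection of faces is a face, so for x in K this is the least face
   of K that contains x. *)
Definition Phi K x : set 'cV[R]_n := smallest (face K) [set x].

Definition extreme_vector K x : Prop :=
  [/\ K x, x != 0 & Phi K x = [set a *: x | a in [set a : R | 0 <= a]]].

Definition extreme_rays K : set (set 'cV[R]_n) :=
  [set Phi K x | x in extreme_vector K].

Definition polyhedral_cones (m : nat) : set (set 'cV[R]_n) :=
  [set K | proper_cone K /\ (extreme_rays K #= `I_m)%card].

Definition cone_preserving K : set 'M[R]_n :=
  [set A | forall x, K x -> K (A *m x)].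

Definition primitive_mx K A : Prop :=
  cone_preserving K A /\
  exists2 p : nat, (0 < p)%N &
    forall x, K x -> x != 0 -> interior K ((A ^+ p) *m x).

End Cones.

Arguments polyhedral_cones R n m : clear implicits.

Record digraph (T : Type) :=
  Digraph { vertices : set T ; arcs : rel T }.

Definition digraph_iso (T T' : Type) (D : digraph T) (D' : digraph T') : Prop :=
  exists2 f : T -> T', set_bij (vertices D) (vertices D') f &
    forall u v, vertices D u -> vertices D v -> arcs D u v = arcs D' (f u) (f v).

(* The circuit v_1 -> ... -> v_k -> v_1 is the sequence of its k vertices. *)
Definition circuit (T : eqType) (D : digraph T) (c : seq T) : Prop :=
  [/\ c != [::], forall v, v \in c -> vertices D v & ucycle (arcs D) c].

Definition shortest_circuit_length
    (T : eqType) (D : digraph T) (k : nat) : Prop :=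
  (exists2 c, circuit D c & size c = k) /\
  (forall c, circuit D c -> (k <= size c)%N).

Definition cone_digraph {R : realType} {n : nat}
    (A : 'M[R]_n) (K : set 'cV[R]_n) : digraph (set 'cV[R]_n) :=
  {| vertices := extreme_rays K ;
     arcs := fun F G => `[< exists x y,
       [/\ extreme_vector K x, extreme_vector K y, F = Phi K x, G = Phi K y &
           Phi K y `<=` Phi K (A *m x)] >] |}.

(* The vertex x_i is represented by the natural number i, 1 <= i <= m. *)
Definition F1 (m : nat) : digraph nat :=
  {| vertices := [set i | 1 <= i <= m]%N ;
     arcs := fun i j => [|| (1 <= i <= m - 1)%N && (j == i.+1),
                           (i == m) && (j == 1%N) |
                           (i == m) && (j == 2%N)] |}.

Definition F2 (m : nat) : digraph nat :=
  {| vertices := vertices (F1 m) ;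
     arcs := fun i j => arcs (F1 m) i j || ((i == 1%N) && (j == 3%N)) |}.

Definition complete_loopless_digraph (m : nat) : digraph 'I_m :=
  {| vertices := setT ; arcs := fun i j => i != j |}.

(* Main.v *)
Require Import Defs.
From mathcomp Require Import all_boot all_order all_algebra.
From mathcomp Require Import all_classical all_reals all_analysis.
From mathcomp Require Import zify lra.

Set Implicit Arguments.
Unset Strict Implicit.
Unset Printing Implicit Defensive.

Import Order.TTheory GRing.Theory Num.Theory.
Import numFieldNormedType.Exports.

Local Open Scope classical_set_scope.

(* A shortest circuit c of length m - 1 misses exactly one vertex v, is
   chordless, and an arc u -> v followed by an arc v -> w forces w to be the
   first or the second successor of u on c.  If some such pair skips no vertex
   of c, v is an ear over an arc of c, and minimality leaves only F_1, F_2 and,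
   for m = 3, the complete loopless digraph.  In the remaining cases v has no
   in-arc, or no out-arc, or is a twin of a vertex of c.  These are excluded by
   primitivity: the orbit of an extreme vector under A would stay in faces
   spanned by one or two fixed extreme rays and never reach the interior. *)

Definition thin (T : Type) (s : set T) := forall u v, s u -> s v -> u = v.

Definition out_closed (T : Type) (D : digraph T) (s t : set T) :=
  forall u v, s u -> arcs D u v -> t v.

(* What K-primitivity says about the digraph alone.  Thinness is required
   because A y_1 + A y_2 may span a face with extreme rays that are
   out-neighbours of neither y_1 nor y_2. *)
Definition family_covers (T : Type) (D : digraph T) :=
  forall (S : set (set T)) s0,
    (forall s, S s ->
       exists2 t, S t & out_closed D s t /\ (thin s \/ thin t)) ->
    S s0 -> vertices D `&` s0 !=set0 -> exists2 s, S s & vertices D `<=` s.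

(** * Faces and extreme rays *)

Section ConvexCones.
Local Open Scope ring_scope.
Context {R : realType} {n : nat}.
Implicit Types (K F C : set 'cV[R]_n) (x y z : 'cV[R]_n) (A : 'M[R]_n).
Implicit Types (s t : set (set 'cV[R]_n)).

(** The vectors of [K] dominated by a multiple of [x] in the order of [K] form a face containing
    [x]; conversely, a face containing [x] contains each [a *: x] with [0 <= a], and so all that it
    dominates. *)
Lemma PhiE K x : convex_cone K -> K x ->
  Phi K x = [set y | K y /\ exists2 a : R, 0 <= a & K (a *: x - y)].
Proof.
move=> [K0 KD KZ] Kx; apply/seteqP; split.
- apply: smallest_sub => [|y ->]; last first.
    by split=> //; exists 1; rewrite ?ler01// scale1r subrr.
  split.
  + split=> [|y z [Ky [a a0 Ka]] [Kz [b b0 Kb]]|a y a0 [Ky [b b0 Kb]]].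
    * by split=> //; exists 0; rewrite // scale0r subrr.
    * split; first exact: KD.
      exists (a + b); first exact: addr_ge0.
      by rewrite scalerDl opprD addrACA; apply: KD.
    * split; first exact: KZ.
      exists (a * b); first exact: mulr_ge0.
      by rewrite -scalerA -scalerBr; apply: KZ.
  + by move=> y [].
  + move=> y z [Ky [a a0 Ka]] Kz Kyz; split=> //; exists a => //.
    by rewrite -[a *: x](subrK y) -addrA; apply: KD.
- move=> y [Ky [a a0 Ka]] F [[[F0 FD FZ] FK Fface] Fx].
  by apply: Fface Ky Ka; apply: FZ => //; apply: Fx.
Qed.

Lemma Phi_face K x : convex_cone K -> K x -> face K (Phi K x).
Proof.
move=> cK Kx; have [K0 KD KZ] := cK; split.
- split=> [F [[[] //]]|y z Fy Fz F|a y a0 Fy F] [fF Fx];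
    have [[F0 FD FZ] _ _] := fF.
  + by apply: FD; [apply: Fy|apply: Fz].
  + by apply: FZ => //; apply: Fy.
- by move=> y; rewrite PhiE// => -[].
- move=> y z Fy Kz Kyz F [fF Fx]; have [_ _ ff] := fF.
  by apply: ff Kz Kyz; apply: Fy.
Qed.

Lemma Phi_refl K x : Phi K x x.
Proof. by move=> F [_]; apply. Qed.

Lemma Phi_sub K x y : convex_cone K -> K x -> Phi K x y ->
  Phi K y `<=` Phi K x.
Proof.
move=> cK Kx xy; apply: smallest_sub; first exact: Phi_face.
by move=> _ ->.
Qed.

Lemma Phi_cone K x y : convex_cone K -> K x -> Phi K x y -> K y.
Proof. by move=> cK Kx; rewrite PhiE// => -[]. Qed.

Lemma Phi0 K : proper_cone K -> Phi K 0 = [set 0].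
Proof.
move=> [cK _ ptK _]; have [K0 _ _] := cK.
rewrite -ptK PhiE//; apply/seteqP; split=> y /=.
  move=> [Ky [a _]]; rewrite scaler0 sub0r => KNy; split=> //.
  by exists (- y); rewrite ?opprK.
move=> [Ky [z Kz zy]]; split=> //; exists 0 => //.
by rewrite scaler0 sub0r -zy opprK.
Qed.

Lemma proper_cone_eq0 K x : proper_cone K -> K x -> K (- x) -> x = 0.
Proof.
move=> [_ _ ptK _] Kx KNx; suff : [set 0 : 'cV[R]_n] x by [].
by rewrite -ptK; split=> //; exists (- x); rewrite ?opprK.
Qed.

(** For [y] in [K], [x - d *: y] stays in [K] for some small [d > 0], so [y] is dominated by
    [d^-1 *: x]. *)
Lemma interior_Phi K x : convex_cone K -> interior K x -> Phi K x = K.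
Proof.
move=> cK intx; have Kx : K x by exact: interior_subset intx.
rewrite PhiE//; apply/seteqP; split=> [y []//|y Ky]; split=> //.
have cf : {for 0, continuous (fun t : R => x - t *: y)}.
  apply: cvgB; first exact: cvg_cst.
  by apply: cvgZr_tmp; exact: cvg_id.
have : nbhs (0 : R) ((fun t : R => x - t *: y) @^-1` K).
  by apply: cf; rewrite scale0r subr0.
move=> /nbhs_ballP[e /= e0 be].
have /be /= Ke : ball (0 : R) e (e / 2).
  by rewrite /ball /= sub0r normrN gtr0_norm ?divr_gt0//; lra.
have : 0 < e / 2 by lra.
move: (e / 2) Ke => d Kd d0.
exists d^-1; first by rewrite invr_ge0 ltW.
have [_ _ KZ] := cK.
rewrite -[X in _ - X]scale1r -(mulVf (lt0r_neq0 d0)) -scalerA -scalerBr.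
by apply: KZ => //; rewrite invr_ge0 ltW.
Qed.

(* The face of [x - t y] for the largest [t] with [x - t y] in [K]. *)
Lemma face_exit K x y : proper_cone K -> K x -> K y -> y != 0 ->
  exists t : R, [/\ 0 <= t, K (x - t *: y) & ~ Phi K (x - t *: y) y].
Proof.
move=> pK Kx Ky y0; have [cK clK _ _] := pK; have [K0 KD KZ] := cK.
pose T := [set t : R | K (x - t *: y)].
have T0 : T 0 by rewrite /T /= scale0r subr0.
have Tdown a b : T b -> a <= b -> T a.
  rewrite /T /= => Tb ab.
  rewrite (_ : x - a *: y = (x - b *: y) + (b - a) *: y); last first.
    by rewrite scalerBl addrA subrK.
  by apply: KD => //; apply: KZ => //; rewrite subr_ge0.
(* Otherwise [x - d^-1 *: y], and hence [d *: x - y], lies in [K] for every [d > 0]; letting [d]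
   tend to [0] puts [- y] in [K], against pointedness. *)
have bT : has_ubound T.
  apply: contrapT => unb; move/eqP: y0; apply.
  apply: (proper_cone_eq0 pK Ky).
  have Tall a : T a.
    apply: contrapT => Ta; apply: unb; exists a => b Tb.
    by case: (leP b a) => // /ltW ab; case: Ta; apply: Tdown Tb ab.
  have cf : continuous (fun t : R => t *: x - y).
    move=> t; apply: cvgB; last exact: cvg_cst.
    by apply: cvgZr_tmp; exact: cvg_id.
  have clT : closed ((fun t : R => t *: x - y) @^-1` K).
    by apply: preimage_closed => // t _; exact: cf.
  suff : ((fun t : R => t *: x - y) @^-1` K) 0 by rewrite /= scale0r sub0r.
  apply: clT => B /nbhs_ballP[e /= e0 be].
  have : ball (0 : R) e (e / 2).
    by rewrite /ball /= sub0r normrN gtr0_norm ?divr_gt0//; lra.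
  have : 0 < e / 2 by lra.
  move: (e / 2) => d d0 /be Bd; exists d; split=> //=.
  rewrite -[y]scale1r -(mulfV (lt0r_neq0 d0)) -scalerA -scalerBr.
  by apply: KZ; [exact: ltW|exact: Tall].
have clT : closed T.
  apply: (@preimage_closed _ _ (fun t : R => x - t *: y)) => // t _.
  apply: cvgB; first exact: cvg_cst.
  by apply: cvgZr_tmp; exact: cvg_id.
have Tsup : T (sup T).
  by apply: clT; apply: closure_sup => //; exists 0.
have Kt : K (x - sup T *: y) := Tsup.
exists (sup T); split=> //; first exact: ub_le_sup.
rewrite PhiE// => -[_ [a a0 Ka]].
(* With [u := x - sup T *: y], add [u] to [a *: u - y] and divide by [a + 1], which is positive even
   for [a = 0]: the supremum would be exceeded. *)
have : T (sup T + (a + 1)^-1).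
  rewrite /T /=; have a10 : 0 < a + 1 by lra.
  rewrite scalerDl opprD addrA; move: (x - _) Kt Ka => u Ku Ka.
  rewrite (_ : u - _ = (a + 1)^-1 *: ((a *: u - y) + u)); last first.
    rewrite addrAC -[X in _ + X - _]scale1r -scalerDl scalerBr scalerA.
    by rewrite mulVf ?lt0r_neq0// !scale1r.
  by apply: KZ; [rewrite invr_ge0 ltW|exact: KD].
move=> /(ub_le_sup bT); rewrite gerDl invr_le0; lra.
Qed.

(** [W] has the largest dimension among the subspaces inside [D]; a vector of [D] outside [W] would
    enlarge it. *)
Lemma linear_set_vspace (D : set 'cV[R]_n) : D 0 ->
  (forall (a : R) x y, D x -> D y -> D (a *: x + y)) ->
  exists W : {vspace 'cV[R]_n}, forall x, (x \in W) <-> D x.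
Proof.
move=> D0 Dl.
pose P k := `[< exists2 W : {vspace 'cV[R]_n},
  (forall x, x \in W -> D x) & \dim W = k >].
have exP : exists k, P k.
  by exists 0%N; apply/asboolP; exists 0%VS; rewrite ?dimv0// => x;
    rewrite memv0 => /eqP ->.
have ubP k : P k -> (k <= \dim {: 'cV[R]_n})%N.
  by move=> /asboolP[W _ <-]; rewrite dimvS// subvf.
have [k /asboolP[W WD dW] kmax] := ex_maxnP exP ubP.
exists W => x; split; first exact: WD.
move=> Dx; apply: contrapT => /negP xW.
have : P (\dim (W + <[x]>)%VS).
  apply/asboolP; exists (W + <[x]>)%VS => //.
  move=> _ /memv_addP[u Wu [_ /vlineP[a ->] ->]].
  by rewrite addrC; apply: Dl => //; apply: WD.
move=> /kmax; rewrite -dW leqNgt => /negP; apply.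
have sW : (W <= W + <[x]>)%VS by exact: addvSl.
rewrite (ltn_leqif (dimv_leqif_sup sW)); apply/negP => /subvP/(_ x).
by rewrite (negbTE xW) => h; have := h (subvP (addvSr _ _) _ (memv_line x)).
Qed.

(** Take [W = F - F]. If [x = u - v] lies in [K] with [u], [v] in [F], then [u - x = v] is in [K],
    so the face property gives [x] in [F]. The dimension of [W] makes induction on faces
    possible. *)
Lemma face_span K F : convex_cone K -> face K F ->
  exists W : {vspace 'cV[R]_n},
    (forall x, F x -> x \in W) /\ (forall x, K x -> x \in W -> F x).
Proof.
move=> [K0 KD KZ] [[F0 FD FZ] FK Fface].
have [||W WP] := @linear_set_vspace [set u - v | u in F & v in F].
- by exists 0 => //; exists 0 => //; rewrite subrr.
- move=> a _ _ [x Fx [y Fy <-]] [z Fz [w Fw <-]].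
  (* Only nonnegative scalars act on [F]; a negative [a] exchanges the roles of [x] and [y]. *)
  have [a0|/ltW a0] := leP 0 a.
    exists (a *: x + z); first by apply: FD => //; exact: FZ.
    exists (a *: y + w); first by apply: FD => //; exact: FZ.
    by rewrite scalerBr opprD addrACA.
  have na0 : 0 <= - a by lra.
  exists (- a *: y + z); first by apply: FD => //; exact: FZ.
  exists (- a *: x + w); first by apply: FD => //; exact: FZ.
  by rewrite scalerBr opprD addrACA !scaleNr opprK [- _ + _]addrC.
exists W; split=> [x Fx|x Kx].
  by apply/WP; exists x => //; exists 0 => //; rewrite subr0.
move=> /WP[u Fu [v Fv uv]]; apply: Fface Fu Kx _.
by rewrite -uv opprB addrC subrK; exact: FK.
Qed.

(* Minkowski's theorem as an induction principle.  If x is not extreme, two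
   line searches write x as z + b y' with z and y' in faces of smaller
   dimension than that of x. *)
Lemma extreme_cone_ind K x C : proper_cone K -> K x -> convex_cone C ->
  (forall y, extreme_vector K y -> Phi K x y -> C y) -> C x.
Proof.
move=> pK; have [cK _ _ _] := pK; have [K0 KD KZ] := cK => Kx cC.
have [C0 CD CZ] := cC.
have [W [sW Ws]] := face_span cK (Phi_face cK Kx).
have [d dW] : exists d, (\dim W < d)%N by exists (\dim W).+1.
elim: d x W Kx sW Ws dW => // d IH x W Kx sW Ws dW ext.
(* The vector [u] is in [W] but not in the span [V] of the face of [z], so [V :&: W] is strictly
   smaller than [W]. *)
have drop z u : Phi K x z -> Phi K x u -> ~ Phi K z u -> C z.
  move=> xz xu nzu; have Kz := Phi_cone cK Kx xz.
  have [V [sV Vs]] := face_span cK (Phi_face cK Kz).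
  apply: (IH z (V :&: W)%VS) => //.
  - move=> y zy; rewrite memv_cap sV// sW//.
    exact: (Phi_sub cK Kx xz).
  - by move=> y Ky; rewrite memv_cap => /andP[/Vs]; auto.
  - rewrite -ltnS; apply: leq_trans dW; rewrite ltnS.
    rewrite (ltn_leqif (dimv_leqif_sup (capvSr _ _))).
    apply/negP => /subvP/(_ u (sW _ xu)); rewrite memv_cap => /andP[uV _].
    by apply: nzu; apply: Vs => //; exact: Phi_cone xu.
  - by move=> y ey zy; apply: ext => //; exact: (Phi_sub cK Kx xz).
have [->//|xn0] := eqVneq x 0.
have [exx|nex] := pselect (extreme_vector K x).
  by apply: ext => //; exact: Phi_refl.
have [y xy ny] : exists2 y, Phi K x y & forall a : R, 0 <= a -> y <> a *: x.
  apply: contrapT => h; apply: nex; split=> //; apply/seteqP; split=> y.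
    move=> xy; apply: contrapT => ny; apply: h; exists y => // a a0 ya.
    by apply: ny; exists a.
  move=> [a a0 <-]; have [[_ _ FZ] _ _] := Phi_face cK Kx.
  by apply: FZ => //; exact: Phi_refl.
have Ky := Phi_cone cK Kx xy.
have [a [a0 Ka na]] := face_exit pK Ky Kx xn0.
set y' := y - a *: x in Ka na.
have y'n0 : y' != 0 by apply/eqP => /subr0_eq; exact: ny.
have xy' : Phi K x y'.
  have [_ _ ff] := Phi_face cK Kx; apply: ff xy Ka _.
  by rewrite /y' opprB addrC subrK; exact: KZ.
have [b [b0 Kb nb]] := face_exit pK Kx Ka y'n0.
rewrite -[x](subrK (b *: y')); apply: CD; last first.
  by apply: CZ => //; apply: drop na => //; exact: Phi_refl.
apply: drop nb => //; have [_ _ ff] := Phi_face cK Kx.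
apply: ff Kb _; first exact: Phi_refl.
by rewrite opprB addrC subrK; exact: KZ.
Qed.

(** * Orbits followed through the extreme rays of their faces *)

Definition supported K s x :=
  K x /\ forall y, extreme_vector K y -> Phi K x y -> s (Phi K y).

(** A union of rays, not their hull; it is convex once [s] is thin, when at most one ray remains.
    The vector [0] is listed apart since [s] may contain no extreme ray. *)
Definition rays_union K s : set 'cV[R]_n :=
  [set x | x = 0 \/
    exists y, [/\ extreme_vector K y, s (Phi K y) & Phi K y x]].

Lemma rays_union_cone K s : convex_cone K -> thin s ->
  convex_cone (rays_union K s).
Proof.
move=> cK ths; split; first by left.
- move=> x y [->|[u [eu su ux]]]; first by rewrite add0r.
  move=> [->|[v [ev sv vy]]]; first by rewrite addr0; right; exists u.
  right; exists u; split=> //.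
  have [Ku _ _] := eu; have [[_ FD _] _ _] := Phi_face cK Ku.
  by apply: FD => //; rewrite (ths _ _ su sv).
- move=> a x a0 [->|[u [eu su ux]]]; first by left; rewrite scaler0.
  right; exists u; split=> //.
  have [Ku _ _] := eu; have [[_ _ FZ] _ _] := Phi_face cK Ku.
  exact: FZ.
Qed.

Lemma supported_rays_union K s x : proper_cone K -> thin s ->
  supported K s x -> rays_union K s x.
Proof.
move=> pK ths [Kx sx]; have [cK _ _ _] := pK.
apply: (extreme_cone_ind pK Kx (rays_union_cone cK ths)) => y ey xy.
by right; exists y; split; [|exact: sx|exact: Phi_refl].
Qed.

Lemma extreme_Phi_eq K x y : proper_cone K -> extreme_vector K x ->
  Phi K x y -> y != 0 -> Phi K y = Phi K x.
Proof.
move=> pK ex xy y0; have [Kx x0 Px] := ex; have [cK _ _ _] := pK.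
apply/seteqP; split; first exact: (Phi_sub cK Kx xy).
move: (xy); rewrite {1}Px => -[a a0 ay].
suff yx : Phi K y x by exact: (Phi_sub cK (Phi_cone cK Kx xy) yx).
have [[_ _ FZ] _ _] := Phi_face cK (Phi_cone cK Kx xy).
have an0 : a != 0 by apply: contra_neq y0 => a_0; rewrite -ay a_0 scale0r.
rewrite -[x]scale1r -(mulVf an0) -scalerA ay.
by apply: FZ; [rewrite invr_ge0|exact: Phi_refl].
Qed.

Lemma rays_union_supported K s x : proper_cone K ->
  rays_union K s x -> supported K s x.
Proof.
move=> pK; have [cK _ _ _] := pK; have [K0 _ _] := cK.
case=> [->|[u [eu su ux]]].
  split=> // y [_ y0 _]; rewrite Phi0// => y0'.
  by move: y0; rewrite y0' eqxx.
have [Ku _ _] := eu; split; first exact: Phi_cone ux.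
move=> y [_ y0 _] xy; rewrite (extreme_Phi_eq pK eu)//.
exact: (Phi_sub cK Ku ux).
Qed.

Lemma Phi_mulmx K A x y : convex_cone K -> cone_preserving K A -> K x ->
  Phi K x y -> Phi K (A *m x) (A *m y).
Proof.
move=> cK pA Kx; rewrite !PhiE//; last exact: pA.
move=> [Ky [a a0 Ka]]; split; first exact: pA.
by exists a => //; rewrite scalemxAr -mulmxBr; exact: pA.
Qed.

(** If [s] is thin, [x] is [0] or lies on one extreme ray, and the arcs from that ray control the
    face of [A *m x]. If [t] is thin, [A] sends every extreme vector of the face of [x] to [0] or
    onto the single ray of [t], and Minkowski's theorem extends this to [x]. *)
Lemma supported_mulmx K A s t x : proper_cone K -> cone_preserving K A ->
  out_closed (cone_digraph A K) s t -> thin s \/ thin t ->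
  supported K s x -> supported K t (A *m x).
Proof.
move=> pK pA st; have [cK _ _ _] := pK.
have supp_ext y : extreme_vector K y -> s (Phi K y) -> supported K t (A *m y).
  move=> ey sy; have [Ky _ _] := ey; split; first exact: pA.
  move=> z ez yz; apply: st sy _; apply/asboolP; exists y, z; split=> //.
  exact: (Phi_sub cK (pA _ Ky) yz).
case=> [ths|tht] sx.
- have [->|[y [ey sy yx]]] := supported_rays_union pK ths sx.
    by rewrite mulmx0; apply: rays_union_supported => //; left.
  have [Ky _ _] := ey; have [_ tAy] := supp_ext y ey sy; split.
    by apply: pA; exact: Phi_cone yx.
  move=> z ez xz; apply: tAy => //.
  exact: (Phi_sub cK (pA _ Ky) (Phi_mulmx cK pA Ky yx)).
- apply: rays_union_supported => //.
  have [Wt0 WtD WtZ] := rays_union_cone cK tht.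
  have [Kx sPx] := sx.
  apply: (extreme_cone_ind (C := [set z | rays_union K t (A *m z)]) pK Kx).
    split=> /= [|y z|a y a0]; first by rewrite mulmx0.
    + by rewrite mulmxDr; exact: WtD.
    + by rewrite -scalemxAr; exact: WtZ.
  move=> y ey xy; apply: supported_rays_union => //.
  by apply: supp_ext => //; exact: sPx.
Qed.

(** Start from an extreme vector [x] with ray in [s0]. Each power of [A] keeps its image supported
    on some member of [S]; after [p] steps the image is interior, its face is [K], and that member
    contains all extreme rays. *)
Lemma primitive_family K A : proper_cone K -> primitive_mx K A ->
  family_covers (cone_digraph A K).
Proof.
move=> pK [pA [p p0 Ap]] S s0 HS Ss0 [_ [[x ex <-] s0x]].
have [Kx x0 _] := ex; have [cK _ _ _] := pK.
have [s Ss sx] : exists2 s, S s & supported K s ((A ^+ p) *m x).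
  elim: (p) => [|k [s Ss sx]].
    rewrite expr0 mul1mx; exists s0 => //; apply: rays_union_supported => //.
    by right; exists x; split=> //; exact: Phi_refl.
  have [t St [st th]] := HS _ Ss; exists t => //.
  by rewrite exprS -mulmxA; exact: supported_mulmx st th sx.
exists s => // _ [y ey <-]; apply: sx.2 => //.
by rewrite interior_Phi//; [have [] := ey|exact: Ap].
Qed.

End ConvexCones.

(** * Digraphs with a shortest circuit through all vertices but one *)

Section ShortestCircuit.
Context {T : eqType} (D : digraph T) (c : seq T).
Hypothesis circ_c : circuit D c.
Hypothesis min_c : forall c', circuit D c' -> (size c <= size c')%N.

(** The arc closes the stretch [w :: s1] of [c] from [w] to [u] into a circuit. By minimality no
    vertex of [c] is left in the remainder [s2], so [w] follows [u]. *)
Lemma shortest_circuit_chordless u w : u \in c -> w \in c -> arcs D u w ->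
  w = next c u.
Proof.
have [_ cV /andP[cyc unic]] := circ_c.
move=> uc wc uw; have [i s def] := rot_to wc.
have uniws : uniq (w :: s) by rewrite -def rot_uniq.
have us : u \in w :: s by rewrite -def mem_rot.
have cycs : cycle (arcs D) (w :: s) by rewrite -def rot_cycle.
rewrite -(next_rot i unic) def.
have sV v : v \in w :: s -> vertices D v by rewrite -def mem_rot; exact: cV.
have szc : size c = (size s).+1 by rewrite -(size_rot i) def.
case: (splitPl us) uniws cycs sV szc => s1 s2 lst uniws.
rewrite /= rcons_cat cat_path => /andP[ps1 _] sV szc.
have /min_c : circuit D (w :: s1).
  split=> // [v vs|].
    by apply: sV; rewrite -cat_cons mem_cat vs.
  rewrite /ucycle /= rcons_path ps1 lst uw /=.
  by move: uniws; rewrite -cat_cons cat_uniq => /andP[].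
rewrite szc /= size_cat => s20; have {s20}s20 : s2 = [::].
  by apply: size0nil; clear -s20; lia.
move: uniws; rewrite s20 cats0 => /cycle_next /=.
by rewrite rcons_path lst => /andP[_ /eqP].
Qed.

(** The detour through [v] closes the stretch from [w] to [u]. It adds one vertex and omits those
    strictly between [u] and [w], so minimality allows at most one of the latter. *)
Lemma shortest_circuit_ear v u w : vertices D v -> v \notin c ->
  u \in c -> w \in c -> arcs D u v -> arcs D v w ->
  w = next c u \/ w = next c (next c u).
Proof.
have [_ cV /andP[cyc unic]] := circ_c.
move=> Vv vc uc wc uv vw; have [i s def] := rot_to wc.
have uniws : uniq (w :: s) by rewrite -def rot_uniq.
have us : u \in w :: s by rewrite -def mem_rot.
have vs : v \notin w :: s by rewrite -def mem_rot.
have cycs : cycle (arcs D) (w :: s) by rewrite -def rot_cycle.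
rewrite -!(next_rot i unic) def.
have sV z : z \in w :: s -> vertices D z by rewrite -def mem_rot; exact: cV.
have szc : size c = (size s).+1 by rewrite -(size_rot i) def.
case: (splitPl us) uniws cycs sV szc vs => s1 s2 lst uniws.
rewrite /= rcons_cat cat_path => /andP[ps1 _] sV szc vs.
have /min_c : circuit D (v :: w :: s1).
  split=> // [z|].
    rewrite inE => /orP[/eqP -> //|zs].
    by apply: sV; rewrite -cat_cons mem_cat zs.
  rewrite /ucycle cons_uniq /= rcons_path vw ps1 lst uv /=.
  move: vs uniws; rewrite -cat_cons mem_cat negb_or => /andP[-> _].
  by rewrite cat_uniq => /andP[].
rewrite szc /= size_cat => s20; have {s20}s20 : (size s2 <= 1)%N
  by clear -s20; lia.
case: s2 s20 uniws {sV szc vs us def} => [|a [|//]] _ /cycle_next /=.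
  by rewrite cats0 rcons_path lst => /andP[_ /eqP]; left.
rewrite rcons_path cat_path last_cat lst /= andbT.
move=> /andP[/andP[_ /eqP na] /eqP nn].
by right; rewrite na.
Qed.

Lemma shortest_circuit_loopless v : (1 < size c)%N -> vertices D v ->
  ~~ arcs D v v.
Proof.
move=> c1 Vv; apply/negP => vv.
suff /min_c : circuit D [:: v] by rewrite leqNgt c1.
by split=> // [z|]; [rewrite inE => /eqP ->|rewrite /ucycle /= vv].
Qed.

End ShortestCircuit.

(** * Isomorphisms read off an enumeration of the vertices *)

Section SequenceIso.
Context {T : eqType} (D : digraph T) (s : seq T).
Hypotheses (uniq_s : uniq s) (verts_s : vertices D = [set` s]).

Lemma digraph_iso_seq (x0 : T) (F : digraph nat) :
  vertices F = [set i | 1 <= i <= size s]%N ->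
  (forall k l, (k < size s)%N -> (l < size s)%N ->
    arcs D (nth x0 s k) (nth x0 s l) = arcs F k.+1 l.+1) ->
  digraph_iso D F.
Proof.
move=> VF HF; exists (fun u => (index u s).+1).
  rewrite VF verts_s; split.
  - by move=> u /= us; rewrite index_mem.
  - move=> u v; rewrite !inE /= => us vs [] /(congr1 (nth x0 s)).
    by rewrite !nth_index.
  - move=> [|k] //= ks; exists (nth x0 s k) => /=; first exact: mem_nth.
    by rewrite index_uniq.
move=> u v; rewrite verts_s /= => us vs.
by rewrite -HF ?index_mem// !nth_index.
Qed.

Lemma digraph_iso_complete (x0 : T) (m : nat) : size s = m.+1 ->
  (forall k l, (k <= m)%N -> (l <= m)%N ->
    arcs D (nth x0 s k) (nth x0 s l) = (k != l)) ->
  digraph_iso D (complete_loopless_digraph m.+1).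
Proof.
move=> szs HD; have lt_index u : u \in s -> (index u s < m.+1)%N.
  by rewrite -szs index_mem.
exists (fun u => inord (index u s)).
  rewrite verts_s; split=> //.
  - move=> u v; rewrite !inE /= => us vs /(congr1 val) /=.
    rewrite !inordK ?lt_index// => /(congr1 (nth x0 s)).
    by rewrite !nth_index.
  - move=> k _; have ks : (k < size s)%N by rewrite szs.
    exists (nth x0 s k) => /=; first exact: mem_nth.
    by rewrite index_uniq// inord_val.
move=> u v; rewrite verts_s /= => us vs.
rewrite -[in LHS](nth_index x0 us) -[in LHS](nth_index x0 vs).
have [iu iv] := (lt_index u us, lt_index v vs).
by rewrite HD// -val_eqE /= !inordK.
Qed.

End SequenceIso.

(** * Positions on the circuit and the spanning ear *)

Definition cyclic_succ p k := if k.+1 == p then 0 else k.+1.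

Lemma cyclic_succ_lt p k : k < p -> cyclic_succ p k < p.
Proof. by rewrite /cyclic_succ; case: eqP; lia. Qed.

(** An in-arc of the ear vertex from the last position confines its out-arcs to positions [0] and
    [1]. The next lemma is the mirror image, for an out-arc to position [0]. *)
Lemma cyclic_succ_from_last p l : 1 < p ->
  l = cyclic_succ p p.-1 \/ l = cyclic_succ p (cyclic_succ p p.-1) ->
  l = 0 \/ l = 1.
Proof. by rewrite /cyclic_succ; do !case: eqP; lia. Qed.

Lemma cyclic_succ_to_first p k : k < p ->
  0 = cyclic_succ p k \/ 0 = cyclic_succ p (cyclic_succ p k) ->
  k = p.-1 \/ k = p - 2.
Proof. by rewrite /cyclic_succ; do !case: eqP; lia. Qed.

(** The two optional arcs of the ear vertex, to position [1] and from position [p - 2], coexist only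
    on a circuit of length two; this is where the complete digraph arises. *)
Lemma cyclic_succ_twin p : 1 < p ->
  1 = cyclic_succ p (p - 2) \/ 1 = cyclic_succ p (cyclic_succ p (p - 2)) ->
  p = 2.
Proof. by rewrite /cyclic_succ; do !case: eqP; lia. Qed.

Lemma next_nth_uniq (T : eqType) (x0 : T) (c : seq T) k : uniq c ->
  (k < size c)%N ->
  next c (nth x0 c k) = nth x0 c (cyclic_succ (size c) k).
Proof.
move=> unic kc; rewrite next_nth mem_nth// index_uniq//.
rewrite /cyclic_succ; case: c unic kc => //= y c _; rewrite ltnS eqSS => kc.
(* At the last position the lookup runs past the tail and returns its default, the head [y]: this is
   the wrap-around. *)
have [->|kc'] := eqVneq; first by rewrite nth_default.
by apply: set_nth_default; lia.
Qed.

Section Ear.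
Context {T : eqType} (D : digraph T) (v : T) (c : seq T).
Hypothesis circ_c : circuit D c.
Hypothesis min_c : forall c', circuit D c' -> (size c <= size c')%N.
Hypothesis size_c : (1 < size c)%N.
Hypothesis v_notin : v \notin c.
Hypothesis verts : vertices D = [set` v :: c].

(** Chordlessness fixes the arcs inside [c], and the ear bound all arcs at [v] but two, [a] and [b].
    With both the digraph is complete, with neither it is [F1], and with exactly one it is [F2]. *)
Lemma spanning_ear_iso :
  arcs D v (nth v c 0) -> arcs D (nth v c (size c).-1) v ->
  [\/ digraph_iso D (F1 (size c).+1), digraph_iso D (F2 (size c).+1) |
      size c = 2 /\ digraph_iso D (complete_loopless_digraph 3)].
Proof.
move=> v0 pv; have [_ cV /andP[cyc unic]] := circ_c.
have Vv : vertices D v by rewrite verts /= mem_head.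
have nthc k : (k < size c)%N -> nth v c k \in c by exact: mem_nth.
have nth_inj k l : (k < size c)%N -> (l < size c)%N ->
    nth v c k = nth v c l -> k = l.
  by move=> kc lc /eqP; rewrite nth_uniq// => /eqP.
have vv : arcs D v v = false.
  by apply/negbTE; exact: (shortest_circuit_loopless min_c).
have c0 := ltnW size_c.
have pc : ((size c).-1 < size c)%N by rewrite prednK.
have p2c : (size c - 2 < size c)%N by rewrite ltn_subrL.
have cc k l : (k < size c)%N -> (l < size c)%N ->
    arcs D (nth v c k) (nth v c l) = (l == cyclic_succ (size c) k).
  move=> kc lc; apply/idP/eqP => [kl|->].
    have := shortest_circuit_chordless circ_c min_c (nthc _ kc) (nthc _ lc) kl.
    by rewrite next_nth_uniq// => /nth_inj; apply=> //; exact: cyclic_succ_lt.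
  by rewrite -next_nth_uniq//; apply: next_cycle => //; exact: nthc.
have ear k l : (k < size c)%N -> (l < size c)%N ->
    arcs D (nth v c k) v -> arcs D v (nth v c l) ->
    l = cyclic_succ (size c) k \/
    l = cyclic_succ (size c) (cyclic_succ (size c) k).
  move=> kc lc kv vl; have kc' := cyclic_succ_lt kc.
  have := shortest_circuit_ear circ_c min_c Vv v_notin.
  move=> /(_ _ _ (nthc _ kc) (nthc _ lc) kv vl).
  rewrite !next_nth_uniq//; case=> /nth_inj h; [left|right]; apply: h => //.
  exact: cyclic_succ_lt.
have [a Ha] : exists a, arcs D v (nth v c 1) = a by eexists.
have [b Hb] : exists b, arcs D (nth v c (size c - 2)) v = b by eexists.
have vc l : (l < size c)%N ->
    arcs D v (nth v c l) = (l == 0)%N || (l == 1)%N && a.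
  move=> lc; have [->|l0] := eqVneq l 0%N; first by rewrite v0.
  have [->|l1] := eqVneq l 1%N; first by rewrite Ha.
  apply/negbTE/negP => vl; have := ear _ _ pc lc pv vl.
  by case/(cyclic_succ_from_last size_c) => /eqP; apply/negP.
have cv k : (k < size c)%N ->
    arcs D (nth v c k) v = (k == (size c).-1)%N || (k == size c - 2)%N && b.
  move=> kc; have [->|l0] := eqVneq k _; first by rewrite pv.
  have [->|l1] := eqVneq k (size c - 2)%N; first by rewrite Hb.
  apply/negbTE/negP => kv; have := ear _ _ kc c0 kv v0.
  by case/(cyclic_succ_to_first kc) => /eqP; apply/negP.
have ab : a -> b -> size c = 2.
  move=> at_ bt; have := ear _ _ p2c size_c; rewrite Ha Hb => /(_ bt at_).
  exact: cyclic_succ_twin.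
have univ : uniq (v :: c) by rewrite /= v_notin.
case: a b {Ha Hb} vc cv ab => [] [] vc cv ab.
- constructor 3; have c2 := ab isT isT; split=> //.
  apply: (digraph_iso_complete univ verts (x0 := v)); first by rewrite /= c2.
  by move=> [|k] [|l] /= kc lc; rewrite ?vv ?vc ?cv ?cc //;
    rewrite ?c2; move: kc lc; rewrite /cyclic_succ; clear => kc lc;
    do ?[case: ifP => /eqP ?]; lia.
- constructor 2; apply: (digraph_iso_seq univ verts (x0 := v)) => //.
  by move=> [|k] [|l] /= kc lc; rewrite ?vv ?vc ?cv ?cc //;
    move: (size c) size_c kc lc; rewrite /cyclic_succ; clear=> p p1 kc lc;
    do ?[case: ifP => /eqP ?]; lia.
- constructor 2.
  (* With [b] alone, the last vertex of [c] must play [x_1] and [v] must play [x_2]; the arc from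
     the last vertex to position [0] becomes [x_1 -> x_3]. *)
  pose s := nth v c (size c).-1 :: v :: take (size c).-1 c.
  have szs : size s = (size c).+1 by rewrite /= size_take; case: ifP; lia.
  have sc : (v :: c) =i s.
    move=> u; rewrite -[in LHS](cat_take_drop (size c).-1 c) !inE mem_cat.
    rewrite (drop_nth v) ?prednK// drop_oversize ?prednK// !inE.
    by rewrite orbA orbC.
  have unis : uniq s by rewrite -(eq_uniq _ sc).
  have vertss : vertices D = [set` s].
    by rewrite verts; apply/seteqP; split=> u /=; rewrite sc.
  apply: (digraph_iso_seq unis vertss (x0 := v)); first by rewrite szs.
  have nt k : (k.+2 < (size c).+1)%N ->
      nth v (take (size c).-1 c) k = nth v c k.
    by move=> ?; rewrite nth_take//; lia.
  have lt_c k : (k.+2 < (size c).+1)%N -> (k < size c)%N by move=> /ltnW.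
  rewrite szs; move=> [|[|k]] [|[|l]] /= kc lc; rewrite ?nt//;
    rewrite ?vv ?vc ?cv ?cc ?pc ?lt_c //;
    move: (size c) size_c kc lc; rewrite /cyclic_succ; clear=> p p1 kc lc;
    do ?[case: ifP => /eqP ?]; lia.
- constructor 1; apply: (digraph_iso_seq univ verts (x0 := v)) => //.
  by move=> [|k] [|l] /= kc lc; rewrite ?vv ?vc ?cv ?cc //;
    move: (size c) size_c kc lc; rewrite /cyclic_succ; clear=> p p1 kc lc;
    do ?[case: ifP => /eqP ?]; lia.
Qed.

End Ear.

(** * Exclusion of the other configurations by primitivity *)

Lemma thin_set1 (T : Type) (u : T) : thin [set u].
Proof. by move=> x y -> ->. Qed.

Lemma circuit_complement (T : choiceType) (D : digraph T) (c : seq T) m :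
  (vertices D #= `I_m.+1)%card -> circuit D c -> size c = m ->
  exists2 v, v \notin c & vertices D = [set` v :: c].
Proof.
move=> cardV [_ cV /andP[_ unic]] szc.
have finV : finite_set (vertices D) by apply/finite_setP; exists m.+1.
pose s : seq T := finmap.enum_fset (fset_set (vertices D)).
have unis : uniq s by exact: finmap.fset_uniq.
have szs : size s = m.+1 by exact: card_fset_set.
have Vs u : vertices D u <-> u \in s.
  by rewrite -[X in X u <-> _](fset_setK finV).
have [v vs vc] : exists2 v, v \in s & v \notin c.
  apply: contrapT => h; have : (size s <= size c)%N.
    apply: uniq_leq_size => // u us; apply: contrapT => /negP uc.
    by apply: h; exists u.
  by rewrite szs szc ltnn.
exists v => //.
have univ : uniq (v :: c) by rewrite /= vc.
have sub : {subset v :: c <= s}.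
  by move=> u; rewrite inE => /orP[/eqP ->//|/cV /Vs].
have szle : (size s <= size (v :: c))%N by rewrite szs /= szc.
have [_ eqs] := uniq_min_size univ sub szle.
by apply/seteqP; split=> u /=; rewrite eqs => /Vs.
Qed.

Lemma shortest_circuit_iso (T : choiceType) (D : digraph T) m :
  (2 < m)%N -> (vertices D #= `I_m)%card ->
  (forall u v, arcs D u v -> vertices D v) -> family_covers D ->
  shortest_circuit_length D (m - 1) ->
  [\/ digraph_iso D (F1 m), digraph_iso D (F2 m) |
      m = 3 /\ digraph_iso D (complete_loopless_digraph 3)].
Proof.
case: m => // m m1 cardV arcV fam; rewrite subn1 /= => -[[c circ szc] minc].
have [v vc verts] := circuit_complement cardV circ szc.
have Vv : vertices D v by rewrite verts /= mem_head.
have [_ cV /andP[cyc unic]] := circ.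
rewrite -szc in m1 minc *; rewrite ltnS in m1.
have loopless u := @shortest_circuit_loopless _ _ _ minc u m1.
have [c0 c1] : nth v c 0 \in c /\ nth v c 1 \in c.
  by split; apply: mem_nth => //; apply: ltnW.
have c01 : nth v c 0 != nth v c 1 by rewrite nth_uniq//; exact: ltnW.
have not_cover s : (forall u w, u \in c -> w \in c -> s u -> s w -> u = w) ->
    ~ (vertices D `<=` s).
  move=> ths Vs; move/eqP: c01; apply; apply: ths => //; exact: Vs (cV _ _).
have not_cover1 u : ~ (vertices D `<=` [set u]).
  by apply: not_cover => x y _ _; exact: thin_set1.
have outc u w : u \in c -> arcs D u w -> w = v \/ w = next c u.
  move=> uc uw; have := arcV _ _ uw; rewrite verts /= inE => /orP[/eqP|wc].
    by left.
  by right; exact: (shortest_circuit_chordless circ minc).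
have outv w : arcs D v w -> w \in c.
  move=> vw; have := arcV _ _ vw; rewrite verts /= inE => /orP[/eqP wv|//].
  by have := loopless _ Vv; rewrite -{2}wv vw.
have [[i ic [iv vi]]|noshort] :=
    pselect (exists2 i, i \in c & arcs D i v /\ arcs D v (next c i)).
  have nic : next c i \in c by rewrite mem_next.
  (* Rotated to start at [next c i], the circuit ends at [i], so [v] is an ear from its last to its
     first vertex. *)
  have [k s def] := rot_to nic.
  have circ' : circuit D (rot k c).
    split=> [|u|]; first by rewrite def.
      by rewrite mem_rot; exact: cV.
    by rewrite /ucycle rot_cycle rot_uniq cyc.
  have /cycle_next : uniq (rot k c) by rewrite rot_uniq.
  rewrite {2}def /= rcons_path => /andP[_]; rewrite /= next_rot// => /eqP.
  move=> /(can_inj (prev_next unic)) lasti.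
  have := @spanning_ear_iso _ D v (rot k c) circ'.
  rewrite size_rot mem_rot => /(_ minc m1 vc); rewrite -(size_rot k c).
  rewrite nth_last def /= lasti => h.
  have {h} : [\/ digraph_iso D (F1 (size s).+2), digraph_iso D (F2 (size s).+2)
    | (size s).+1 = 2 /\ digraph_iso D (complete_loopless_digraph 3)].
    apply: h => //; rewrite verts; apply/seteqP.
    by split=> u /=; rewrite -def !inE mem_rot.
  by case=> [?|?|[-> ?]]; [constructor 1|constructor 2|constructor 3].
exfalso.
have [z vz] : exists z, arcs D v z.
  apply: contrapT => no_out.
  (* Without an out-arc at [v], the orbit passes from [[set v]] to the empty set. *)
  have [|||s [->|->]] := fam [set [set v]; set0] [set v].
  - move=> _ [->|->]; (exists set0; first by right); split=> //.
    + by move=> _ w -> vw; apply: no_out; exists w.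
    + by left; exact: thin_set1.
    + by left.
  - by left.
  - by exists v.
  - exact: not_cover1.
  - by apply: not_cover.
have zc := outv _ vz.
have [i ic iv] : exists2 i, i \in c & arcs D i v.
  apply: contrapT => noI.
  (* Without an in-arc at [v], every singleton on [c] is sent into the next one, and the orbit never
     leaves single rays. *)
  have [|||_ [u uc <-]] := fam [set [set u] | u in [set` c]] [set nth v c 0].
  - move=> _ [u /= uc <-]; exists [set next c u].
      by exists (next c u) => //=; rewrite mem_next.
    split; last by left; exact: thin_set1.
    move=> _ w -> uw; have [wv|//] := outc _ _ uc uw.
    by case: noI; exists u => //; rewrite -wv.
  - by exists (nth v c 0).
  - by exists (nth v c 0); split=> //; exact: cV.
  - exact: not_cover1.
have ear := shortest_circuit_ear circ minc Vv vc.
have out_t w : arcs D v w -> w = next c (next c i).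
  move=> vw; have [wi|//] := ear _ _ ic (outv _ vw) iv vw.
  by case: noshort; exists i => //; rewrite -wi.
have in_t j : j \in c -> arcs D j v -> j = i.
  move=> jc jv; have := out_t _ vz.
  have [zj|->] := ear _ _ jc zc jv vz.
    by case: noshort; exists j => //; rewrite -zj.
  by move=> /(can_inj (prev_next unic)) /(can_inj (prev_next unic)).
(* Now [v] is a twin of [next c i]: both lie between [i] and [next c (next c i)]. The family of
   singletons on [c] together with [t] is closed, with [[set i]] sent into [t] and [t] into a
   singleton; each such step has a thin end. *)
pose t : set T := [set v; next c i].
have nic : next c i \in c by rewrite mem_next.
have [|||s [[u /= uc <-]|->]] :=
    fam ([set [set u] | u in [set` c]] `|` [set t]) [set nth v c 0].
- move=> _ [[u /= uc <-]|->].
    have [ui|ui] := eqVneq u i.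
      exists t; first by right.
      split; last by left; exact: thin_set1.
      by move=> _ w -> /(outc _ _ uc); rewrite ui.
    exists [set next c u].
      by left; exists (next c u) => //=; rewrite mem_next.
    split; last by left; exact: thin_set1.
    move=> _ w -> uw; have [wv|//] := outc _ _ uc uw.
    by move/eqP: ui; case; apply: in_t => //; rewrite -wv.
  exists [set next c (next c i)].
    by left; exists (next c (next c i)) => //=; rewrite !mem_next.
  split; last by right; exact: thin_set1.
  move=> _ w [->|->]; first exact: out_t.
  (* An arc from [next c i] to [v] would give [next c i = i], hence a loop at [i]. *)
  move=> /[dup] niw /(outc _ _ nic)[wv|//]; exfalso.
  have : arcs D i (next c i) by exact: next_cycle.
  rewrite (in_t _ nic); last by rewrite -wv.
  exact/negP/loopless/cV.
- by left; exists (nth v c 0).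
- by exists (nth v c 0); split=> //; exact: cV.
- exact: not_cover1.
- apply: not_cover => u w uc wc [uv|->] [wv|->] //.
  + by rewrite -uv uc in vc.
  + by rewrite -uv uc in vc.
  + by rewrite -wv wc in vc.
Qed.

(** * Girth of the extremal digraphs *)

Section IsoCircuits.
Context {T T' : eqType} (D : digraph T) (D' : digraph T') (f : T -> T').
Hypothesis bij_f : set_bij (vertices D) (vertices D') f.
Hypothesis arcs_f : forall u v, vertices D u -> vertices D v ->
  arcs D u v = arcs D' (f u) (f v).

Lemma path_map_iso x s : (forall v, v \in x :: s -> vertices D v) ->
  path (arcs D') (f x) (map f s) = path (arcs D) x s.
Proof.
elim: s x => //= y s IH x Vs; rewrite IH => [|v vs]; last first.
  by apply: Vs; rewrite inE vs orbT.
by rewrite arcs_f//; apply: Vs; rewrite !inE eqxx ?orbT.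
Qed.

Lemma circuit_map_iso c : (forall v, v \in c -> vertices D v) ->
  circuit D' (map f c) <-> circuit D c.
Proof.
move=> Vc; have [fV finj _] := bij_f.
have uf : uniq (map f c) = uniq c.
  by apply: map_inj_in_uniq => u v uc vc; apply: finj; rewrite inE; exact: Vc.
have cf : cycle (arcs D') (map f c) = cycle (arcs D) c.
  case: c Vc {uf} => //= x s Vs; rewrite -map_rcons path_map_iso// => v.
  by rewrite -rcons_cons mem_rcons !inE orbA orbb; exact: Vs.
rewrite /circuit /ucycle uf cf; split=> -[c0 _ ->]; split=> //.
  by apply: contra_neq c0 => ->.
  by case: c c0 {uf cf Vc}.
by move=> _ /mapP[u /Vc Vu ->]; exact: fV.
Qed.

Lemma shortest_circuit_length_map k :
  shortest_circuit_length D' k -> shortest_circuit_length D k.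
Proof.
have [fV _ fsurj] := bij_f.
move=> [[c' circ' szc'] minc']; split; last first.
  move=> c circ; rewrite -(size_map f); apply: minc'.
  by have [_ cV _] := circ; apply/circuit_map_iso.
have [c cV def] : exists2 c, (forall v, v \in c -> vertices D v) & map f c = c'.
  have [_ + _] := circ'; elim: (c') => [|x s IH] Vs; first by exists [::].
  have [|c cV <-] := IH; first by move=> v vs; apply: Vs; rewrite inE vs orbT.
  have [u Vu <-] := fsurj _ (Vs x (mem_head _ _)).
  by exists (u :: c) => // v; rewrite inE => /orP[/eqP ->|/cV].
by exists c; [apply/circuit_map_iso; rewrite ?def|rewrite -szc' -def size_map].
Qed.

End IsoCircuits.

Lemma shortest_circuit_length_iso (T T' : eqType) (D : digraph T)
    (D' : digraph T') k :
  digraph_iso D D' -> shortest_circuit_length D' k ->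
  shortest_circuit_length D k.
Proof. by move=> [f bf af]; exact: (shortest_circuit_length_map bf af). Qed.

(** Arcs not leaving [m] increase the label, so every circuit passes through [m]. It drops from
    there to [1] or [2] and then climbs back too slowly to be shorter than [m - 1]. *)
Lemma F2_circuit_size m c : (2 < m)%N -> circuit (F2 m) c ->
  (m - 1 <= size c)%N.
Proof.
move=> m2 [c0 cV /andP[cyc unic]].
have [mc|mc] := boolP (m \in c); last first.
  exfalso; case: c c0 cV cyc {unic} mc => // x s _ _.
  rewrite /= rcons_path => /andP[ps lx] ms.
  have le_last y r : m \notin y :: r -> path (arcs (F2 m)) y r ->
      (y <= last y r)%N.
    elim: r y => //= z r IH y yr /andP[yz pr].
    apply: leq_trans (IH z _ pr); last first.
      by move: yr; rewrite inE negb_or => /andP[].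
    by move: yr yz; rewrite inE negb_or => /andP[ym _] /=; lia.
  have := le_last _ _ ms ps.
  have : last x s != m by apply: contraNneq ms => <-; exact: mem_last.
  by move: lx => /=; lia.
have [k s def] := rot_to mc.
have : cycle (arcs (F2 m)) (rot k c) by rewrite rot_cycle.
rewrite -(size_rot k) def; case: s {def} => [|y s] /=.
  by rewrite andbT; lia.
rewrite rcons_path => /and3P[my ps ly].
(* Along arcs of [F2], [i] with [1] raised to [2] grows by at most one. *)
pose h i := maxn i 2.
have le_last x r : path (arcs (F2 m)) x r -> (h (last x r) <= h x + size r)%N.
  elim: r x => [|z r IH] x /=; first by rewrite addn0.
  move=> /andP[xz /IH]; rewrite /h; move: xz; lia.
have := le_last _ _ ps; rewrite /h; move: my ly => /=; lia.
Qed.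

(** Lets both digraphs share one lower bound, proved for [F2], and one extremal circuit, found in
    [F1]. *)
Lemma F1_sub_F2 m c : circuit (F1 m) c -> circuit (F2 m) c.
Proof.
move=> [c0 cV /andP[cyc unic]]; split=> //; rewrite /ucycle unic andbT.
by apply: sub_cycle cyc => i j /= ->.
Qed.

(** This circuit omits only [x_1] and is closed by the arc from [x_m] to [x_2]. *)
Lemma F1_circuit m : (2 < m)%N -> circuit (F1 m) (iota 2 (m - 1)).
Proof.
move=> m2; split=> [|i|]; first by rewrite -size_eq0 size_iota; lia.
  by rewrite mem_iota /=; lia.
rewrite /ucycle iota_uniq andbT (_ : m - 1 = (m - 2).+1)%N; last by lia.
rewrite /= rcons_path.
(* The endpoint is computed along with the path because the closing arc must start at [m]. *)
have pathF k n : (0 < k)%N -> (k + n <= m)%N ->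
    path (arcs (F1 m)) k (iota k.+1 n) && (last k (iota k.+1 n) == k + n)%N.
  elim: n k => [|n IH] k k0 kn; first by rewrite /= addn0 eqxx.
  rewrite [iota _ _]/= [path _ _ _]/= [last _ _]/=.
  have /IH : (0 < k.+1)%N by [].
  rewrite addSnnS => /(_ kn) /andP[-> ->]; rewrite !andbT /=; lia.
have /pathF : (0 < 2)%N by [].
move=> /(_ (m - 2)%N) => /(_ ltac:(lia)) /andP[-> /eqP ->] /=; lia.
Qed.

Lemma F1_shortest m : (2 < m)%N -> shortest_circuit_length (F1 m) (m - 1).
Proof.
move=> m2; split; last by move=> c /F1_sub_F2 /(F2_circuit_size m2).
by exists (iota 2 (m - 1)); [exact: F1_circuit|rewrite size_iota].
Qed.

Lemma F2_shortest m : (2 < m)%N -> shortest_circuit_length (F2 m) (m - 1).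
Proof.
move=> m2; split; last by move=> c /(F2_circuit_size m2).
exists (iota 2 (m - 1)); last by rewrite size_iota.
exact: F1_sub_F2 (F1_circuit m2).
Qed.

Lemma complete_loopless_shortest m :
  (1 < m)%N -> shortest_circuit_length (complete_loopless_digraph m) 2.
Proof.
move=> m1; split.
  by exists [:: Ordinal (ltnW m1); Ordinal m1].
by move=> [|i [|j c]] // [] // _ _; rewrite /ucycle /= eqxx.
Qed.

Theorem lemma4p1 (R : realType) (m n : nat) (n_ge3 : (3 <= n)%N)
    (n_le_m : (n <= m)%N) (K : set 'cV[R]_n) (A : 'M[R]_n)
    (K_poly : polyhedral_cones R n m K) (A_prim : primitive_mx K A) :
  shortest_circuit_length (cone_digraph A K) (m - 1)%N <->
  [\/ digraph_iso (cone_digraph A K) (F1 m),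
      digraph_iso (cone_digraph A K) (F2 m) |
      [/\ m = 3%N, n = 3%N &
          digraph_iso (cone_digraph A K) (complete_loopless_digraph 3)]].
Proof.
have m_ge3 : (2 < m)%N by exact: leq_trans n_le_m.
have [pK cardE] := K_poly; split.
- have arcE F G : arcs (cone_digraph A K) F G -> extreme_rays K G.
    by move=> /asboolP[_ [y [_ ey _ -> _]]]; exists y.
  have fam := primitive_family pK A_prim.
  have iso :=
    @shortest_circuit_iso _ (cone_digraph A K) m m_ge3 cardE arcE fam.
  move=> /iso[?|?|[m3 ?]].
  + by constructor 1.
  + by constructor 2.
  + by constructor 3; split=> //; apply/eqP; rewrite eqn_leq n_ge3 -m3 n_le_m.
- have transfer := @shortest_circuit_length_iso _ _ (cone_digraph A K).
  case=> [iso|iso|[m3 _ iso]].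
  + exact: transfer iso (F1_shortest m_ge3).
  + exact: transfer iso (F2_shortest m_ge3).
  + by rewrite m3; apply: transfer iso _; exact: complete_loopless_shortest.
Qed.
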